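(* Let $m>0$. For the regularized Hamiltonian $\Gamma$, let the initial condition be $P_1(0)=0$, $P_2(0)=2m^{3/2}$, $Q_1(0)=R>0$ and $Q_2(0)=0$, where $R\in(0,\sqrt{A_0}]$. Assume that at time $s_1=s_1(R)$ one has $Q_2>0$ and $Q_1=0$, which means that the (first) simultaneous binary collision occurs. Also assume $Q_2>0$ for $0<s\le s_1$. Then $P_2(s_1(R),R)$ is a continuous function of $R$.
   Context: Regularized system. Let $$\Gamma=\frac{1}{16}Q_2^2P_1^2+\frac{Q_2^2P_1^2-4Q_1Q_2P_1P_2+4Q_1^2P_2^2}{16m}-m^2Q_1^2-2mQ_2^2-\frac{2mQ_1^2Q_2^2}{Q_1^2+Q_2^2}-\frac{Q_1^2Q_2^2}{2Q_1^2+Q_2^2}-Q_1^2Q_2^2E,\qquad E=-1,$$ with Hamilton's equations $Q_i'=\partial\Gamma/\partial P_i$, $P_i'=-\partial\Gamma/\partial Q_i$ ($i=1,2$), $'=d/ds$. The solution with initial data $Q_1(0)=R$, $Q_2(0)=0$, $P_1(0)=0$, $P_2(0)=2m^{3/2}$ (which lies on $\Gamma=0$) is denoted $Q_i(s,R),P_i(s,R)$. The time $s_1=s_1(R)>0$ is the first time a simultaneous binary collision (SBC) happens, where SBC means $Q_1=0$, $Q_2\neq0$. Physical meaning: four collinear bodies of masses $1,m,m,1$ at positions $x_1,x_2,-x_2,-x_1$ ($x_1\ge x_2\ge0$), with total energy $-1$. Here $Q_1^2=x_1-x_2$, $Q_2^2=2x_2$, $P_1=4Q_1\dot x_1$, $P_2=2Q_2(\dot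 x_1+m\dot x_2)$, and physical time $t$ satisfies $dt/ds=Q_1^2Q_2^2$, $t(0)=0$. The motion starts at a binary collision of the inner bodies with $x_1(0)=A=R^2$, $x_2(0)=0$, $\dot x_1(0)=0$. Constant $A_0$: $A_0>0$ is the constant such that, with $t_1$ the physical time of the first SBC, the second body (position $x_2$) has no turning point for $t\in(0,t_1]$ whenever $0<A\le A_0$, and has at least one turning point for $t\in(0,t_1]$ if $A>A_0$. (A turning point of a body occurs at a time $t^*$ when its velocity $v$ vanishes and there are $t_a<t^*<t_b$ such that $v$ has one strict sign on $[t_a,t^* )$ and the opposite strict sign on $(t^*,t_b]$.) *)

(* Defs.v *)
From Stdlib Require Import Reals.
From Coquelicot Require Import Coquelicot.
Open Scope R_scope.

(** The energy [E] is fixed to [-1].  The value at [q1 = q2 = 0] (total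
    collapse), where the denominators vanish, is meaningless; [is_solution]
    below keeps trajectories away from it. *)
Definition energy : R := -1.

Definition Gamma (m q1 q2 p1 p2 : R) : R :=
  1 / 16 * q2 ^ 2 * p1 ^ 2
  + (q2 ^ 2 * p1 ^ 2 - 4 * q1 * q2 * p1 * p2 + 4 * q1 ^ 2 * p2 ^ 2) / (16 * m)
  - m ^ 2 * q1 ^ 2
  - 2 * m * q2 ^ 2
  - 2 * m * q1 ^ 2 * q2 ^ 2 / (q1 ^ 2 + q2 ^ 2)
  - q1 ^ 2 * q2 ^ 2 / (2 * q1 ^ 2 + q2 ^ 2)
  - q1 ^ 2 * q2 ^ 2 * energy.

Definition hamilton_at (m : R) (Q1 Q2 P1 P2 : R -> R) (s : R) : Prop :=
  is_derive Q1 s (Derive (fun p => Gamma m (Q1 s) (Q2 s) p (P2 s)) (P1 s)) /\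
  is_derive Q2 s (Derive (fun p => Gamma m (Q1 s) (Q2 s) (P1 s) p) (P2 s)) /\
  is_derive P1 s (- Derive (fun q => Gamma m q (Q2 s) (P1 s) (P2 s)) (Q1 s)) /\
  is_derive P2 s (- Derive (fun q => Gamma m (Q1 s) q (P1 s) (P2 s)) (Q2 s)).

(** Meant for [lo < 0 < hi], so that the initial time is interior. *)
Definition is_solution (m r lo hi : R) (Q1 Q2 P1 P2 : R -> R) : Prop :=
  (Q1 0 = r /\ Q2 0 = 0 /\ P1 0 = 0 /\ P2 0 = 2 * Rpower m (3 / 2)) /\
  (forall s, lo < s < hi ->
     (Q1 s <> 0 \/ Q2 s <> 0) /\ hamilton_at m Q1 Q2 P1 P2 s).

Definition SBC (Q1 Q2 : R -> R) (s : R) : Prop := Q1 s = 0 /\ Q2 s <> 0.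

Definition first_SBC (Q1 Q2 : R -> R) (s1 : R) : Prop :=
  0 < s1 /\ SBC Q1 Q2 s1 /\ (forall s, 0 < s < s1 -> ~ SBC Q1 Q2 s).

Definition is_physical_time (lo hi : R) (Q1 Q2 T : R -> R) : Prop :=
  T 0 = 0 /\
  (forall s, lo < s < hi -> is_derive T s ((Q1 s) ^ 2 * (Q2 s) ^ 2)).

(** [x2] is the position of the second body as a function of physical time;
    its values outside the image of [T] are irrelevant. *)
Definition is_second_position (lo hi : R) (Q2 T x2 : R -> R) : Prop :=
  forall s, lo < s < hi -> (Q2 s) ^ 2 = 2 * x2 (T s).

Definition pos_velocity (x : R -> R) (t : R) : Prop :=
  exists v, is_derive x t v /\ 0 < v.

Definition neg_velocity (x : R -> R) (t : R) : Prop :=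
  exists v, is_derive x t v /\ v < 0.

(** At a collision of the body its velocity is infinite, hence [x] has no
    derivative there and the collision is not a turning point. *)
Definition turning_point (x : R -> R) (t : R) : Prop :=
  is_derive x t 0 /\
  exists ta tb, ta < t < tb /\
    (((forall u, ta <= u < t -> pos_velocity x u) /\
      (forall u, t < u <= tb -> neg_velocity x u))
     \/
     ((forall u, ta <= u < t -> neg_velocity x u) /\
      (forall u, t < u <= tb -> pos_velocity x u))).

(** The motion starting with [x1 = A], i.e. [Q1 = sqrt A], reaches its first
    simultaneous binary collision at regularized time [s1], with physical time
    [T] and second body [x2]. *)
Definition motion_to_SBC (m A s1 : R) (T x2 : R -> R) : Prop :=
  exists (lo hi : R) (Q1 Q2 P1 P2 : R -> R),
    lo < 0 /\ s1 < hi /\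
    is_solution m (sqrt A) lo hi Q1 Q2 P1 P2 /\
    first_SBC Q1 Q2 s1 /\
    is_physical_time lo hi Q1 Q2 T /\
    is_second_position lo hi Q2 T x2.

Definition is_A0 (m A0 : R) : Prop :=
  0 < A0 /\
  (forall A s1 T x2, 0 < A <= A0 -> motion_to_SBC m A s1 T x2 ->
     ~ exists t, 0 < t <= T s1 /\ turning_point x2 t) /\
  (forall A s1 T x2, A0 < A -> motion_to_SBC m A s1 T x2 ->
     exists t, 0 < t <= T s1 /\ turning_point x2 t).

(* Main.v *)
(** Energy conservation forces [P1 ^ 2 = 32 m ^ 2 / (m + 1)] at an SBC, so [Q1]
    crosses [0] there with nonzero speed.  Solutions depend continuously on
    their initial data on compact time intervals (Gronwall, in a neighbourhood
    of a trajectory that stays away from total collapse), hence the first zero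
    of [Q1], and with it the value of [P2] at that zero, is continuous in the
    initial data. *)

Require Import Defs.
From Stdlib Require Import Reals.
From Coquelicot Require Import Coquelicot.
From Stdlib Require Import Psatz.
Open Scope R_scope.

(** * Analysis in one variable: hitting times, sign changes, Gronwall's inequality *)

Lemma is_derive_continuity_pt (f : R -> R) (x l : R) :
  is_derive f x l -> continuity_pt f x.
Proof.
  intros H; apply continuity_pt_filterlim.
  apply (ex_derive_continuous (V := R_NormedModule)); exists l; exact H.
Qed.

(* [auto_derive] leaves its derivatives in eta-expanded form. *)
Lemma is_derive_unique_eta (f : R -> R) (x l : R) :
  is_derive f x l -> Derive (fun y : R => f y) x = l.
Proof. exact (is_derive_unique f x l). Qed.

Lemma continuity_pt_eps (f : R -> R) (x e : R) :
  continuity_pt f x -> 0 < e ->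
  exists d, 0 < d /\ forall y, Rabs (y - x) < d -> Rabs (f y - f x) < e.
Proof.
  intros H He.
  apply continuity_pt_filterlim in H.
  destruct (proj1 (filterlim_locally _ _) H (mkposreal e He)) as [d Hd].
  exists d; split; [apply cond_pos | exact Hd].
Qed.

(** The hitting time is the supremum of the times up to which [f] stays below [c]. Unlike the bare
    intermediate value theorem this controls [f] on the whole initial segment, as the continuation
    argument in [gronwall] requires. *)
Lemma first_hit (f : R -> R) (a b c : R) :
  a <= b -> (forall s, a <= s <= b -> continuity_pt f s) ->
  f a < c -> c <= f b ->
  exists t, a <= t <= b /\ f t = c /\ forall s, a <= s <= t -> f s <= c.
Proof.
  intros Hab Hf Ha Hb.
  set (E := fun t => a <= t <= b /\ forall s, a <= s <= t -> f s < c).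
  assert (Ea : E a).
  { split; [lra|]. intros s Hs. replace s with a by lra. exact Ha. }
  destruct (completeness E) as [t [Hub Hlub]].
  { exists b; intros x [Hx _]; lra. }
  { exists a; exact Ea. }
  assert (Hat : a <= t) by (apply Hub; exact Ea).
  assert (Htb : t <= b) by (apply Hlub; intros x [Hx _]; lra).
  assert (Hlt : forall s, a <= s < t -> f s < c).
  { intros s Hs. apply Rnot_le_lt; intros Hc.
    assert (t <= s); [|lra].
    apply Hlub; intros x [Hx Hx'].
    apply Rnot_lt_le; intros Hsx.
    specialize (Hx' s ltac:(lra)); lra. }
  assert (Htc : f t = c).
  (* If [f t < c], continuity extends [E] beyond its supremum; if [f t > c], continuity contradicts
     [f < c] just to the left of [t]. *)
  { destruct (Rtotal_order (f t) c) as [H | [H | H]]; [|exact H|].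
    - destruct (continuity_pt_eps f t (c - f t) (Hf t ltac:(lra)) ltac:(lra))
        as [d [Hd Hd']].
      assert (Hne : t < b).
      { destruct (Rle_lt_or_eq_dec t b Htb) as [|Heq]; [assumption|].
        rewrite Heq in H; lra. }
      assert (E (Rmin b (t + d / 2))) as HE.
      { pose proof (Rmin_l b (t + d / 2)); pose proof (Rmin_r b (t + d / 2)).
        split.
        - split; [apply Rmin_glb; lra | lra].
        - intros s Hs. destruct (Rlt_dec s t) as [|Hst]; [apply Hlt; lra|].
          assert (Hs' : Rabs (s - t) < d) by (apply Rabs_def1; lra).
          apply Hd' in Hs'. apply Rabs_def2 in Hs'. lra. }
      apply Hub in HE.
      assert (t < Rmin b (t + d / 2)) by (apply Rmin_glb_lt; lra). lra.
    - destruct (continuity_pt_eps f t (f t - c) (Hf t ltac:(lra)) ltac:(lra))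
        as [d [Hd Hd']].
      assert (Hne : a < t).
      { destruct (Rle_lt_or_eq_dec a t Hat) as [|Heq]; [assumption|].
        rewrite <- Heq in H; lra. }
      assert (Hs := Hlt (Rmax a (t - d / 2))).
      assert (a <= Rmax a (t - d / 2) < t).
      { split; [apply Rmax_l | apply Rmax_lub_lt; lra]. }
      assert (Hs' : Rabs (Rmax a (t - d / 2) - t) < d).
      { pose proof (Rmax_r a (t - d / 2)). apply Rabs_def1; lra. }
      apply Hd' in Hs'. apply Rabs_def2 in Hs'. specialize (Hs H0). lra. }
  exists t; repeat split; [lra | lra | exact Htc |].
  intros s Hs. destruct (Rlt_dec s t); [left; apply Hlt; lra|].
  replace s with t by lra. lra.
Qed.

(** Positivity on the left makes the left difference quotients negative, so the nonzero derivative
    [v] is negative and [f] is negative just to the right of [x]. *)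
Lemma crossing (f : R -> R) (a x v : R) :
  is_derive f x v -> v <> 0 -> f x = 0 -> a < x ->
  (forall s, a <= s < x -> 0 < f s) ->
  forall e, 0 < e -> exists t, x < t < x + e /\ f t < 0.
Proof.
  intros Hf Hv Hx Hax Hpos e He.
  assert (Hv' : 0 < Rabs v / 2) by (apply Rabs_pos_lt in Hv; lra).
  apply is_derive_Reals in Hf.
  destruct (Hf _ Hv') as [d Hd].
  (* One step length serves both sides: below [d] for the derivative estimate with tolerance
     [Rabs v / 2], below [e] for the conclusion, and at most [x - a] so that [x - k] lies where [f]
     is known to be positive. *)
  set (k := Rmin (d / 2) (Rmin (e / 2) (x - a))).
  pose proof (cond_pos d) as Hdp.
  assert (Hk : 0 < k /\ k < d /\ k < e /\ k <= x - a).
  { unfold k. pose proof (Rmin_l (d / 2) (Rmin (e / 2) (x - a))).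
    pose proof (Rmin_r (d / 2) (Rmin (e / 2) (x - a))).
    pose proof (Rmin_l (e / 2) (x - a)). pose proof (Rmin_r (e / 2) (x - a)).
    repeat split; try lra. repeat apply Rmin_pos; lra. }
  destruct Hk as [Hk0 [Hkd [Hke Hka]]].
  assert (Hm := Hd (- k) ltac:(lra)
                  ltac:(rewrite Rabs_Ropp, Rabs_pos_eq by lra; lra)).
  assert (Hp := Hd k ltac:(lra) ltac:(rewrite Rabs_pos_eq by lra; lra)).
  rewrite Hx in Hm, Hp.
  assert (Hfm := Hpos (x + - k) ltac:(lra)).
  assert (Hneg : (f (x + - k) - 0) / - k < 0).
  { replace ((f (x + - k) - 0) / - k) with (- (f (x + - k) / k))
      by (field; lra).
    assert (0 < f (x + - k) / k) by (apply Rdiv_lt_0_compat; lra). lra. }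
  apply Rabs_def2 in Hm. apply Rabs_def2 in Hp.
  assert (Hvneg : v < 0).
  { destruct (Rlt_dec v 0); [assumption|].
    rewrite Rabs_pos_eq in Hm by lra. lra. }
  rewrite Rabs_left in Hp by lra.
  exists (x + k). split; [lra|].
  replace (f (x + k)) with ((f (x + k) - 0) / k * k) by (field; lra).
  nra.
Qed.

(** A local form: the differential inequality is available only while [D <= h], because the vector
    field is Lipschitz only near the reference trajectory. The smallness of [D 0] keeps [D] from
    ever reaching [h]. *)
Lemma gronwall (D dD : R -> R) (b K h : R) :
  0 <= b -> 0 <= K -> 0 <= D 0 ->
  (forall s, 0 <= s <= b -> is_derive D s (dD s)) ->
  (forall s, 0 <= s <= b -> D s <= h -> dD s <= K * D s) ->
  D 0 * exp (K * b) < h ->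
  forall s, 0 <= s <= b -> D s <= D 0 * exp (K * b).
Proof.
  intros Hb HK HD0 HD HdD Hh.
  assert (Hexp : forall s, 0 <= s <= b -> exp (K * s) <= exp (K * b)).
  { intros s Hs. destruct (Req_dec s b) as [->|Hne]; [lra|].
    destruct (Req_dec K 0) as [->|HK']; [rewrite !Rmult_0_l; lra|].
    left; apply exp_increasing; nra. }
  assert (Hstep : forall t, 0 <= t <= b -> (forall s, 0 <= s <= t -> D s <= h) ->
                  D t <= D 0 * exp (K * b)).
  { intros t Ht Hle.
    (* The integrating factor makes the derivative of [g] nonpositive as long as [D <= h]. *)
    set (g := fun s => D s * exp (- (K * s))).
    assert (Hg : forall s, 0 <= s <= b ->
                 is_derive g s ((dD s - K * D s) * exp (- (K * s)))).
    { intros s Hs. unfold g. auto_derive.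
      - exists (dD s); apply HD; exact Hs.
      - rewrite (is_derive_unique_eta _ _ _ (HD s Hs)). ring. }
    destruct (MVT_gen g 0 t (fun s => (dD s - K * D s) * exp (- (K * s))))
      as [c [Hc Heq]].
    - intros x. rewrite Rmin_left, Rmax_right by lra. intros; apply Hg; lra.
    - intros x. rewrite Rmin_left, Rmax_right by lra. intros.
      eapply is_derive_continuity_pt, Hg; lra.
    - rewrite Rmin_left, Rmax_right in Hc by lra.
      assert (H1 := HdD c ltac:(lra) (Hle c ltac:(lra))).
      pose proof (exp_pos (- (K * c))).
      assert (0 <= (K * D c - dD c) * exp (- (K * c)))
        by (apply Rmult_le_pos; lra).
      assert (Hgt : g t <= g 0) by nra.
      unfold g in Hgt. rewrite Rmult_0_r, Ropp_0, exp_0, Rmult_1_r in Hgt.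
      apply Rle_trans with (D 0 * exp (K * t)).
      + rewrite exp_Ropp in Hgt.
        pose proof (exp_pos (K * t)).
        apply Rmult_le_compat_r with (r := exp (K * t)) in Hgt; [|lra].
        rewrite Rmult_assoc, Rinv_l, Rmult_1_r in Hgt by lra. exact Hgt.
      + apply Rmult_le_compat_l; [exact HD0 | apply Hexp; lra]. }
  intros s Hs. apply Hstep; [exact Hs|].
  (* Continuation: if [D] exceeded [h], then [Hstep] would apply at a time where [D = h] with
     [D <= h] before it, and would give [D < h] there. *)
  intros u Hu. apply Rnot_lt_le; intros Hhu.
  destruct (first_hit D 0 u h) as [t [Ht [Hth Hle]]].
  - lra.
  - intros x Hx. eapply is_derive_continuity_pt, HD; lra.
  - assert (H := Hexp 0 ltac:(lra)). rewrite Rmult_0_r, exp_0 in H. nra.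
  - lra.
  - assert (H := Hstep t ltac:(lra) Hle). lra.
Qed.

(** * Algebra of bounded Lipschitz functions *)

Section BoundedLipschitz.

Context {T : Type} (d : T -> T -> R) (S : T -> Prop).
Hypothesis d_ge0 : forall x y, 0 <= d x y.

(** Boundedness is built in because products of Lipschitz functions need not be Lipschitz without
    it. A single [K] serves as bound and as Lipschitz constant. *)
Definition bounded_Lipschitz (f : T -> R) : Prop :=
  exists K, 0 <= K /\ (forall x, S x -> Rabs (f x) <= K) /\
    (forall x y, S x -> S y -> Rabs (f x - f y) <= K * d x y).

Lemma bounded_Lipschitz_const (c : R) : bounded_Lipschitz (fun _ => c).
Proof.
  exists (Rabs c); pose proof (Rabs_pos c).
  split; [lra | split; [intros; lra|]].
  intros x y _ _. rewrite Rminus_diag, Rabs_R0. pose proof (d_ge0 x y). nra.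
Qed.

Lemma bounded_Lipschitz_plus (f g : T -> R) :
  bounded_Lipschitz f -> bounded_Lipschitz g ->
  bounded_Lipschitz (fun x => f x + g x).
Proof.
  intros [K [HK [Hf Hf']]] [L [HL [Hg Hg']]].
  exists (K + L); repeat split; [lra | |].
  - intros x Hx. eapply Rle_trans; [apply Rabs_triang|].
    specialize (Hf x Hx); specialize (Hg x Hx); lra.
  - intros x y Hx Hy.
    replace (f x + g x - (f y + g y)) with ((f x - f y) + (g x - g y)) by ring.
    eapply Rle_trans; [apply Rabs_triang|].
    specialize (Hf' x y Hx Hy); specialize (Hg' x y Hx Hy); lra.
Qed.

Lemma bounded_Lipschitz_mult (f g : T -> R) :
  bounded_Lipschitz f -> bounded_Lipschitz g ->
  bounded_Lipschitz (fun x => f x * g x).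
Proof.
  intros [K [HK [Hf Hf']]] [L [HL [Hg Hg']]].
  exists (2 * (K * L)); repeat split; [nra | |].
  - intros x Hx. rewrite Rabs_mult.
    specialize (Hf x Hx); specialize (Hg x Hx).
    pose proof (Rabs_pos (f x)); pose proof (Rabs_pos (g x)). nra.
  - intros x y Hx Hy.
    replace (f x * g x - f y * g y)
      with (f x * (g x - g y) + g y * (f x - f y)) by ring.
    eapply Rle_trans; [apply Rabs_triang|]. rewrite !Rabs_mult.
    replace (2 * (K * L) * d x y) with (K * (L * d x y) + L * (K * d x y))
      by ring.
    apply Rplus_le_compat; apply Rmult_le_compat; auto using Rabs_pos.
Qed.

(** The difference of the inverses is the difference of the values divided by a product that is at
    least [c ^ 2]. In the constant, [/ c] is the bound and the other summand the Lipschitz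
    constant. *)
Lemma bounded_Lipschitz_inv (f : T -> R) (c : R) :
  0 < c -> (forall x, S x -> c <= f x) ->
  bounded_Lipschitz f -> bounded_Lipschitz (fun x => / f x).
Proof.
  intros Hc Hcf [K [HK [Hf Hf']]].
  assert (Hi : 0 < / c) by (apply Rinv_0_lt_compat; exact Hc).
  assert (Hb : forall x, S x -> 0 < / f x <= / c).
  { intros x Hx. specialize (Hcf x Hx). split.
    - apply Rinv_0_lt_compat; lra.
    - apply Rinv_le_contravar; lra. }
  assert (HKc : 0 <= K * (/ c * / c))
    by (apply Rmult_le_pos; [lra | apply Rmult_le_pos; lra]).
  exists (/ c + K * (/ c * / c)); repeat split.
  - lra.
  - intros x Hx. specialize (Hb x Hx). rewrite Rabs_pos_eq by lra.
    lra.
  - intros x y Hx Hy.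
    replace (/ f x - / f y) with (- (f x - f y) * (/ f x * / f y)).
    2:{ pose proof (Hcf x Hx); pose proof (Hcf y Hy); field; lra. }
    rewrite Rabs_mult, Rabs_Ropp.
    pose proof (Hb x Hx); pose proof (Hb y Hy).
    rewrite (Rabs_pos_eq (/ f x * / f y)) by nra.
    apply Rle_trans with (K * d x y * (/ c * / c)).
    + apply Rmult_le_compat; [apply Rabs_pos | nra | auto |].
      apply Rmult_le_compat; lra.
    + assert (0 <= / c * d x y)
        by (apply Rmult_le_pos; [lra | apply d_ge0]).
      lra.
Qed.

Lemma bounded_Lipschitz_ext (f g : T -> R) :
  (forall x, f x = g x) -> bounded_Lipschitz f -> bounded_Lipschitz g.
Proof.
  intros H [K [HK [Hf Hf']]].
  exists K; repeat split; [exact HK | |]; intros; rewrite <- !H; auto.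
Qed.

Lemma bounded_Lipschitz_pow (f : T -> R) (n : nat) :
  bounded_Lipschitz f -> bounded_Lipschitz (fun x => f x ^ n).
Proof.
  intros Hf. induction n as [|n IH]; simpl.
  - apply bounded_Lipschitz_const.
  - apply bounded_Lipschitz_mult; assumption.
Qed.

Lemma bounded_Lipschitz_opp (f : T -> R) :
  bounded_Lipschitz f -> bounded_Lipschitz (fun x => - f x).
Proof.
  intros Hf.
  apply bounded_Lipschitz_ext with (fun x => (-1) * f x).
  { intros; ring. }
  apply bounded_Lipschitz_mult; [apply bounded_Lipschitz_const | exact Hf].
Qed.

End BoundedLipschitz.

(** * Hamilton's equations in closed form and conservation of energy *)

(** [dQ1], [dQ2], [dP1], [dP2] are the right-hand sides of Hamilton's equations, signs included.
    They are written with sums, products, powers and inverses so that the closure lemmas for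
    [bounded_Lipschitz] match their syntax. *)
Definition dQ1 (m q1 q2 p1 p2 : R) : R :=
  q2 ^ 2 * p1 * (/ 8) + (2 * q2 ^ 2 * p1 - 4 * q1 * q2 * p2) * / (16 * m).

Definition dQ2 (m q1 q2 p1 p2 : R) : R :=
  (8 * q1 ^ 2 * p2 - 4 * q1 * q2 * p1) * / (16 * m).

Definition dP1 (m q1 q2 p1 p2 : R) : R :=
  (4 * q2 * p1 * p2 - 8 * q1 * p2 ^ 2) * / (16 * m) + 2 * m ^ 2 * q1
  + 4 * m * q1 * q2 ^ 4 * (/ (q1 ^ 2 + q2 ^ 2)) ^ 2
  + 2 * q1 * q2 ^ 4 * (/ (2 * q1 ^ 2 + q2 ^ 2)) ^ 2
  - 2 * q1 * q2 ^ 2.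

Definition dP2 (m q1 q2 p1 p2 : R) : R :=
  (4 * q1 * p1 * p2 - 2 * q2 * p1 ^ 2) * / (16 * m) + 4 * m * q2
  - q2 * p1 ^ 2 * (/ 8)
  + 4 * m * q2 * q1 ^ 4 * (/ (q1 ^ 2 + q2 ^ 2)) ^ 2
  + 4 * q2 * q1 ^ 4 * (/ (2 * q1 ^ 2 + q2 ^ 2)) ^ 2
  - 2 * q1 ^ 2 * q2.

Lemma sum_squares_pos (x y : R) : x <> 0 \/ y <> 0 -> 0 < x ^ 2 + y ^ 2.
Proof.
  intros [H | H]; pose proof (pow2_gt_0 _ H).
  - pose proof (pow2_ge_0 y); lra.
  - pose proof (pow2_ge_0 x); lra.
Qed.

(** The equations of [is_solution] without its initial data, on a closed interval so that
    compactness is available. *)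
Definition hamilton_on (m b : R) (Q1 Q2 P1 P2 : R -> R) : Prop :=
  forall s, 0 <= s <= b ->
    (Q1 s <> 0 \/ Q2 s <> 0) /\ hamilton_at m Q1 Q2 P1 P2 s.

Section Equations.

Context (m b : R) (Q1 Q2 P1 P2 : R -> R).
Hypothesis m_gt0 : 0 < m.
Hypothesis sol : hamilton_on m b Q1 Q2 P1 P2.

Lemma hamilton_explicit (s : R) : 0 <= s <= b ->
  is_derive Q1 s (dQ1 m (Q1 s) (Q2 s) (P1 s) (P2 s)) /\
  is_derive Q2 s (dQ2 m (Q1 s) (Q2 s) (P1 s) (P2 s)) /\
  is_derive P1 s (dP1 m (Q1 s) (Q2 s) (P1 s) (P2 s)) /\
  is_derive P2 s (dP2 m (Q1 s) (Q2 s) (P1 s) (P2 s)).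
Proof.
  intros Hs. destruct (sol s Hs) as [Hne [H1 [H2 [H3 H4]]]].
  assert (Hpos := sum_squares_pos _ _ Hne).
  pose proof (pow2_ge_0 (Q1 s)).
  split; [|split; [|split]].
  - replace (dQ1 _ _ _ _ _) with
      (Derive (fun p => Gamma m (Q1 s) (Q2 s) p (P2 s)) (P1 s)); [exact H1|].
    apply is_derive_unique; unfold Gamma, dQ1; auto_derive; [trivial|].
    field; lra.
  - replace (dQ2 _ _ _ _ _) with
      (Derive (fun p => Gamma m (Q1 s) (Q2 s) (P1 s) p) (P2 s)); [exact H2|].
    apply is_derive_unique; unfold Gamma, dQ2; auto_derive; [trivial|].
    field; lra.
  - replace (dP1 _ _ _ _ _) with
      (- Derive (fun q => Gamma m q (Q2 s) (P1 s) (P2 s)) (Q1 s)); [exact H3|].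
    rewrite (is_derive_unique _ _ (- dP1 m (Q1 s) (Q2 s) (P1 s) (P2 s)));
      [ring|].
    unfold Gamma, energy, dP1; auto_derive; [repeat split; lra|].
    field; lra.
  - replace (dP2 _ _ _ _ _) with
      (- Derive (fun q => Gamma m (Q1 s) q (P1 s) (P2 s)) (Q2 s)); [exact H4|].
    rewrite (is_derive_unique _ _ (- dP2 m (Q1 s) (Q2 s) (P1 s) (P2 s)));
      [ring|].
    unfold Gamma, energy, dP2; auto_derive; [repeat split; lra|].
    field; lra.
Qed.

Lemma hamilton_continuity (s : R) : 0 <= s <= b ->
  continuity_pt Q1 s /\ continuity_pt Q2 s /\
  continuity_pt P1 s /\ continuity_pt P2 s.
Proof.
  intros Hs. destruct (hamilton_explicit s Hs) as [H1 [H2 [H3 H4]]].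
  split; [|split; [|split]]; eapply is_derive_continuity_pt; eassumption.
Qed.

(** By the chain rule the derivative of [Gamma] along the motion is a sum of products of partial
    derivatives that cancel in pairs; the mean value theorem concludes. *)
Lemma energy_conservation (s : R) : 0 <= s <= b ->
  Gamma m (Q1 s) (Q2 s) (P1 s) (P2 s) = Gamma m (Q1 0) (Q2 0) (P1 0) (P2 0).
Proof.
  intros Hs. set (G := fun u => Gamma m (Q1 u) (Q2 u) (P1 u) (P2 u)).
  assert (HG : forall u, 0 <= u <= b -> is_derive G u 0).
  { intros u Hu. destruct (hamilton_explicit u Hu) as [H1 [H2 [H3 H4]]].
    assert (Hpos := sum_squares_pos _ _ (proj1 (sol u Hu))).
    pose proof (pow2_ge_0 (Q1 u)).
    unfold G, Gamma, energy. auto_derive.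
    - repeat split; try lra; eexists; eassumption.
    - rewrite (is_derive_unique_eta _ _ _ H1),
        (is_derive_unique_eta _ _ _ H2),
        (is_derive_unique_eta _ _ _ H3),
        (is_derive_unique_eta _ _ _ H4).
      unfold dQ1, dQ2, dP1, dP2. field; lra. }
  destruct (MVT_gen G 0 s (fun _ => 0)) as [c [_ Hc]].
  - intros x. rewrite Rmin_left, Rmax_right by lra. intros; apply HG; lra.
  - intros x. rewrite Rmin_left, Rmax_right by lra. intros.
    eapply is_derive_continuity_pt, HG; lra.
  - unfold G in Hc. lra.
Qed.

End Equations.

(** * Lipschitz estimates for the vector field on phase space *)

Definition phase : Type := ((R * R) * (R * R))%type.

Definition phase_dist (x y : phase) : R :=
  Rabs (fst (fst x) - fst (fst y)) + Rabs (snd (fst x) - snd (fst y)) +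
  Rabs (fst (snd x) - fst (snd y)) + Rabs (snd (snd x) - snd (snd y)).

(** A bounded set away from total collapse. The number [c] is a lower bound for both denominators of
    the field, [q1 ^ 2 + q2 ^ 2] and [2 * q1 ^ 2 + q2 ^ 2]. *)
Definition region (M c : R) (x : phase) : Prop :=
  Rabs (fst (fst x)) <= M /\ Rabs (snd (fst x)) <= M /\
  Rabs (fst (snd x)) <= M /\ Rabs (snd (snd x)) <= M /\
  c <= fst (fst x) ^ 2 + snd (fst x) ^ 2.

Lemma phase_dist_ge0 (x y : phase) : 0 <= phase_dist x y.
Proof. unfold phase_dist; repeat apply Rplus_le_le_0_compat; apply Rabs_pos. Qed.

(** Cauchy-Schwarz for four terms: the two sides differ by the sum of the squared pairwise
    differences of the absolute values. It links the distance of the Lipschitz estimates to the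
    Euclidean one used with [gronwall]. *)
Lemma phase_dist_sqr (x y : phase) :
  phase_dist x y ^ 2 <=
  4 * ((fst (fst x) - fst (fst y)) ^ 2 + (snd (fst x) - snd (fst y)) ^ 2 +
       (fst (snd x) - fst (snd y)) ^ 2 + (snd (snd x) - snd (snd y)) ^ 2).
Proof.
  unfold phase_dist.
  rewrite <- (pow2_abs (fst (fst x) - _)), <- (pow2_abs (snd (fst x) - _)),
    <- (pow2_abs (fst (snd x) - _)), <- (pow2_abs (snd (snd x) - _)).
  generalize (Rabs (fst (fst x) - fst (fst y)))
    (Rabs (snd (fst x) - snd (fst y))) (Rabs (fst (snd x) - fst (snd y)))
    (Rabs (snd (snd x) - snd (snd y))).
  intros u v w z.
  pose proof (pow2_ge_0 (u - v)); pose proof (pow2_ge_0 (u - w)).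
  pose proof (pow2_ge_0 (u - z)); pose proof (pow2_ge_0 (v - w)).
  pose proof (pow2_ge_0 (v - z)); pose proof (pow2_ge_0 (w - z)). nra.
Qed.

Lemma bounded_Lipschitz_coordinates (M c : R) :
  bounded_Lipschitz phase_dist (region M c) (fun x => fst (fst x)) /\
  bounded_Lipschitz phase_dist (region M c) (fun x => snd (fst x)) /\
  bounded_Lipschitz phase_dist (region M c) (fun x => fst (snd x)) /\
  bounded_Lipschitz phase_dist (region M c) (fun x => snd (snd x)).
Proof.
  (* A coordinate has Lipschitz constant 1 and bound [M]; the maximum covers both. *)
  assert (HM := Rmax_l 1 M); assert (HM' := Rmax_r 1 M).
  split; [|split; [|split]]; exists (Rmax 1 M); (split; [lra|]);
    (split; [intros x [H1 [H2 [H3 [H4 _]]]]; lra|]);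
    intros x y _ _;
    (apply Rle_trans with (phase_dist x y);
     [ unfold phase_dist;
       pose proof (Rabs_pos (fst (fst x) - fst (fst y)));
       pose proof (Rabs_pos (snd (fst x) - snd (fst y)));
       pose proof (Rabs_pos (fst (snd x) - fst (snd y)));
       pose proof (Rabs_pos (snd (snd x) - snd (snd y))); lra
     | pose proof (phase_dist_ge0 x y); nra ]).
Qed.

Definition uncurry4 (F : R -> R -> R -> R -> R) (x : phase) : R :=
  F (fst (fst x)) (snd (fst x)) (fst (snd x)) (snd (snd x)).

(** The components are polynomials in the coordinates and the two inverses [HI1] and [HI2], so the
    closure lemmas suffice. *)
Lemma bounded_Lipschitz_field (m M c : R) : 0 < c ->
  bounded_Lipschitz phase_dist (region M c) (uncurry4 (dQ1 m)) /\
  bounded_Lipschitz phase_dist (region M c) (uncurry4 (dQ2 m)) /\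
  bounded_Lipschitz phase_dist (region M c) (uncurry4 (dP1 m)) /\
  bounded_Lipschitz phase_dist (region M c) (uncurry4 (dP2 m)).
Proof.
  intros Hc.
  destruct (bounded_Lipschitz_coordinates M c) as [H1 [H2 [H3 H4]]].
  assert (HI1 : bounded_Lipschitz phase_dist (region M c)
                  (fun x => / (fst (fst x) ^ 2 + snd (fst x) ^ 2))).
  { apply (bounded_Lipschitz_inv _ _ phase_dist_ge0 _ c Hc).
    - intros x Hx; apply Hx.
    - apply bounded_Lipschitz_plus;
        apply bounded_Lipschitz_pow; auto using phase_dist_ge0. }
  assert (HI2 : bounded_Lipschitz phase_dist (region M c)
                  (fun x => / (2 * fst (fst x) ^ 2 + snd (fst x) ^ 2))).
  { apply (bounded_Lipschitz_inv _ _ phase_dist_ge0 _ c Hc).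
    - intros x [_ [_ [_ [_ Hx]]]]. pose proof (pow2_ge_0 (fst (fst x))); lra.
    - apply bounded_Lipschitz_plus; [apply bounded_Lipschitz_mult|];
        auto using phase_dist_ge0, bounded_Lipschitz_pow,
          bounded_Lipschitz_const. }
  unfold uncurry4, dQ1, dQ2, dP1, dP2.
  split; [|split; [|split]];
    repeat first
      [ exact HI1 | exact HI2 | exact H1 | exact H2 | exact H3 | exact H4
      | apply (bounded_Lipschitz_const _ _ phase_dist_ge0)
      | apply bounded_Lipschitz_plus
      | apply (bounded_Lipschitz_opp _ _ phase_dist_ge0)
      | apply (bounded_Lipschitz_pow _ _ phase_dist_ge0)
      | apply bounded_Lipschitz_mult ].
Qed.

Lemma bounded_Lipschitz_le (f : phase -> R) (S : phase -> Prop) (K L : R) :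
  K <= L ->
  (forall x y, S x -> S y -> Rabs (f x - f y) <= K * phase_dist x y) ->
  forall x y, S x -> S y -> Rabs (f x - f y) <= L * phase_dist x y.
Proof.
  intros HKL Hf x y Hx Hy. eapply Rle_trans; [apply Hf; assumption|].
  apply Rmult_le_compat_r; [apply phase_dist_ge0 | exact HKL].
Qed.

Lemma region_of_near (M c q1 q2 p1 p2 u1 u2 v1 v2 : R) : 0 < c ->
  region M c ((q1, q2), (p1, p2)) ->
  (q1 - u1) ^ 2 + (q2 - u2) ^ 2 + (p1 - v1) ^ 2 + (p2 - v2) ^ 2
    <= Rmin 1 (c / 4) ->
  region (M + 1) (c / 4) ((u1, u2), (v1, v2)).
Proof.
  intros Hc [H1 [H2 [H3 [H4 H5]]]] HD. simpl in *.
  pose proof (Rmin_l 1 (c / 4)); pose proof (Rmin_r 1 (c / 4)).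
  pose proof (pow2_ge_0 (q1 - u1)); pose proof (pow2_ge_0 (q2 - u2)).
  pose proof (pow2_ge_0 (p1 - v1)); pose proof (pow2_ge_0 (p2 - v2)).
  assert (Hnear : forall a b, Rabs a <= M -> (a - b) ^ 2 <= 1 -> Rabs b <= M + 1).
  { intros a b Ha Hab.
    assert (Rabs (a - b) <= 1) by (apply Rabs_le; nra).
    replace b with (a - (a - b)) by ring.
    eapply Rle_trans; [apply Rabs_triang|]. rewrite Rabs_Ropp. lra. }
  unfold region; simpl fst; simpl snd.
  repeat split.
  - apply (Hnear q1); lra.
  - apply (Hnear q2); lra.
  - apply (Hnear p1); lra.
  - apply (Hnear p2); lra.
  (* These squares give [q ^ 2 <= 2 * (q - u) ^ 2 + 2 * u ^ 2] in each coordinate. Summing,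
     [c <= c / 2 + 2 * (u1 ^ 2 + u2 ^ 2)], whence the bound [c / 4]. *)
  - pose proof (pow2_ge_0 (q1 - 2 * u1)); pose proof (pow2_ge_0 (q2 - 2 * u2)).
    nra.
Qed.

Lemma bounded_on_segment (f : R -> R) (b : R) : 0 <= b ->
  (forall s, 0 <= s <= b -> continuity_pt f s) ->
  exists M, forall s, 0 <= s <= b -> Rabs (f s) <= M.
Proof.
  intros Hb Hf.
  destruct (continuity_ab_maj (fun s => Rabs (f s)) 0 b Hb) as [x [Hx _]].
  - intros s Hs. apply (continuity_pt_comp f Rabs); [auto|].
    apply Rcontinuity_abs.
  - exists (Rabs (f x)); exact Hx.
Qed.

(** Compactness of the time interval: continuous coordinates are bounded, and [c] is the attained
    minimum of [Q1 ^ 2 + Q2 ^ 2], positive because total collapse is excluded. *)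
Lemma trajectory_region (m b : R) (Q1 Q2 P1 P2 : R -> R) :
  0 < m -> 0 <= b -> hamilton_on m b Q1 Q2 P1 P2 ->
  exists M c, 0 < c /\
    forall s, 0 <= s <= b -> region M c ((Q1 s, Q2 s), (P1 s, P2 s)).
Proof.
  intros Hm Hb Hsol.
  assert (Hct := hamilton_continuity m b Q1 Q2 P1 P2 Hm Hsol).
  destruct (bounded_on_segment Q1 b Hb) as [M1 H1]; [intros; now apply Hct|].
  destruct (bounded_on_segment Q2 b Hb) as [M2 H2]; [intros; now apply Hct|].
  destruct (bounded_on_segment P1 b Hb) as [M3 H3]; [intros; now apply Hct|].
  destruct (bounded_on_segment P2 b Hb) as [M4 H4]; [intros; now apply Hct|].
  destruct (continuity_ab_min (fun s => Q1 s ^ 2 + Q2 s ^ 2) 0 b Hb)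
    as [x [Hx Hxb]].
  { intros s Hs. destruct (Hct s Hs) as [C1 [C2 _]].
    apply continuity_pt_plus.
    - apply (continuity_pt_comp Q1 (fun y => y ^ 2)); [exact C1|].
      apply derivable_continuous_pt, derivable_pt_pow.
    - apply (continuity_pt_comp Q2 (fun y => y ^ 2)); [exact C2|].
      apply derivable_continuous_pt, derivable_pt_pow. }
  exists (Rmax (Rmax M1 M2) (Rmax M3 M4)), (Q1 x ^ 2 + Q2 x ^ 2).
  split; [apply sum_squares_pos, (Hsol x Hxb)|].
  intros s Hs. unfold region; simpl fst; simpl snd.
  pose proof (Rmax_l M1 M2); pose proof (Rmax_r M1 M2).
  pose proof (Rmax_l M3 M4); pose proof (Rmax_r M3 M4).
  pose proof (Rmax_l (Rmax M1 M2) (Rmax M3 M4)).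
  pose proof (Rmax_r (Rmax M1 M2) (Rmax M3 M4)).
  specialize (H1 s Hs); specialize (H2 s Hs).
  specialize (H3 s Hs); specialize (H4 s Hs); specialize (Hx s Hs).
  repeat split; lra.
Qed.

(** * Continuous dependence on initial data *)

(** The square of the Euclidean distance is differentiable in time, unlike [phase_dist] in general,
    so [gronwall] can be applied to it. *)
Definition sqdist (Q1 Q2 P1 P2 U1 U2 V1 V2 : R -> R) (s : R) : R :=
  (Q1 s - U1 s) ^ 2 + (Q2 s - U2 s) ^ 2 +
  (P1 s - V1 s) ^ 2 + (P2 s - V2 s) ^ 2.

(* The perturbed solution is only assumed to exist on [[0, b']], which may be
   shorter than the interval [[0, b]] of the reference solution. *)
Lemma continuous_dependence (m b : R) (Q1 Q2 P1 P2 : R -> R) :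
  0 < m -> 0 <= b -> hamilton_on m b Q1 Q2 P1 P2 ->
  forall e, 0 < e -> exists d, 0 < d /\
    forall (b' : R) (U1 U2 V1 V2 : R -> R),
      0 <= b' <= b -> hamilton_on m b' U1 U2 V1 V2 ->
      sqdist Q1 Q2 P1 P2 U1 U2 V1 V2 0 < d ->
      forall s, 0 <= s <= b' -> sqdist Q1 Q2 P1 P2 U1 U2 V1 V2 s < e.
Proof.
  intros Hm Hb Hsol e He.
  destruct (trajectory_region m b Q1 Q2 P1 P2 Hm Hb Hsol) as [M [c [Hc HMc]]].
  destruct (bounded_Lipschitz_field m (M + 1) (c / 4) ltac:(lra))
    as [[K1 [HK1 [_ L1]]] [[K2 [HK2 [_ L2]]]
       [[K3 [HK3 [_ L3]]] [K4 [HK4 [_ L4]]]]]].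
  set (K := K1 + K2 + K3 + K4).
  assert (HK : 0 <= K) by (unfold K; lra).
  (* While the squared distance is at most [h], [region_of_near] keeps the perturbed trajectory in
     the enlarged region where [K] is valid. *)
  set (h := Rmin 1 (c / 4)).
  assert (Hh : 0 < h) by (apply Rmin_pos; lra).
  set (a := Rmin e h).
  assert (Ha : 0 < a) by (apply Rmin_pos; lra).
  (* The growth rate [8 * K] is the one derived at the end of this proof. The exponent uses [b]
     rather than [b'] since this bound must be chosen before [b'] is known. *)
  exists (a / exp (8 * K * b)).
  pose proof (exp_pos (8 * K * b)) as Hexp.
  split; [apply Rdiv_lt_0_compat; lra|].
  intros b' U1 U2 V1 V2 Hb' Hsol' Hd s Hs.
  set (D := sqdist Q1 Q2 P1 P2 U1 U2 V1 V2) in *.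
  assert (Hda : D 0 * exp (8 * K * b) < a).
  { apply Rmult_lt_compat_r with (r := exp (8 * K * b)) in Hd; [|exact Hexp].
    replace (a / exp (8 * K * b) * exp (8 * K * b)) with a in Hd
      by (field; lra).
    exact Hd. }
  assert (HD0 : forall u, 0 <= D u).
  { intros u; unfold D, sqdist.
    repeat apply Rplus_le_le_0_compat; apply pow2_ge_0. }
  assert (Hmono : exp (8 * K * b') <= exp (8 * K * b)).
  { destruct (Req_dec (8 * K * b') (8 * K * b)) as [->|Hne]; [lra|].
    left; apply exp_increasing. assert (8 * K * b' <= 8 * K * b); [|lra].
    apply Rmult_le_compat_l; lra. }
  assert (Hae : a <= e) by apply Rmin_l.
  assert (Hah : a <= h) by apply Rmin_r.
  assert (Hle : D 0 * exp (8 * K * b') <= D 0 * exp (8 * K * b))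
    by (apply Rmult_le_compat_l; auto).
  apply Rle_lt_trans with (D 0 * exp (8 * K * b')); [|lra].
  set (dD := fun u =>
    2 * (Q1 u - U1 u) * (dQ1 m (Q1 u) (Q2 u) (P1 u) (P2 u)
                         - dQ1 m (U1 u) (U2 u) (V1 u) (V2 u)) +
    2 * (Q2 u - U2 u) * (dQ2 m (Q1 u) (Q2 u) (P1 u) (P2 u)
                         - dQ2 m (U1 u) (U2 u) (V1 u) (V2 u)) +
    2 * (P1 u - V1 u) * (dP1 m (Q1 u) (Q2 u) (P1 u) (P2 u)
                         - dP1 m (U1 u) (U2 u) (V1 u) (V2 u)) +
    2 * (P2 u - V2 u) * (dP2 m (Q1 u) (Q2 u) (P1 u) (P2 u)
                         - dP2 m (U1 u) (U2 u) (V1 u) (V2 u))).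
  apply (gronwall D dD b' (8 * K) h); try assumption; try lra; auto.
  - intros u Hu.
    destruct (hamilton_explicit m b _ _ _ _ Hm Hsol u ltac:(lra))
      as [A1 [A2 [A3 A4]]].
    destruct (hamilton_explicit m b' _ _ _ _ Hm Hsol' u Hu)
      as [B1 [B2 [B3 B4]]].
    unfold D, sqdist. auto_derive.
    + repeat split; eexists; eassumption.
    + rewrite (is_derive_unique_eta _ _ _ A1), (is_derive_unique_eta _ _ _ A2),
        (is_derive_unique_eta _ _ _ A3), (is_derive_unique_eta _ _ _ A4),
        (is_derive_unique_eta _ _ _ B1), (is_derive_unique_eta _ _ _ B2),
        (is_derive_unique_eta _ _ _ B3), (is_derive_unique_eta _ _ _ B4).
      unfold dD. ring.
  - intros u Hu HDu.
    set (x := ((Q1 u, Q2 u), (P1 u, P2 u)) : phase).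
    set (y := ((U1 u, U2 u), (V1 u, V2 u)) : phase).
    assert (Hy : region (M + 1) (c / 4) y).
    { apply (region_of_near M c (Q1 u) (Q2 u) (P1 u) (P2 u)); auto.
      apply HMc; lra. }
    assert (Hx : region (M + 1) (c / 4) x).
    { apply (region_of_near M c (Q1 u) (Q2 u) (P1 u) (P2 u)); auto.
      - apply HMc; lra.
      - rewrite !Rminus_diag. fold h. lra. }
    apply (bounded_Lipschitz_le _ _ K1 K ltac:(unfold K; lra) L1 x y Hx) in Hy as N1.
    apply (bounded_Lipschitz_le _ _ K2 K ltac:(unfold K; lra) L2 x y Hx) in Hy as N2.
    apply (bounded_Lipschitz_le _ _ K3 K ltac:(unfold K; lra) L3 x y Hx) in Hy as N3.
    apply (bounded_Lipschitz_le _ _ K4 K ltac:(unfold K; lra) L4 x y Hx) in Hy as N4.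
    assert (Hsq := phase_dist_sqr x y).
    assert (HN := phase_dist_ge0 x y).
    set (N := phase_dist x y) in *.
    assert (HDN : N ^ 2 <= 4 * D u) by exact Hsq.
    assert (Hprod : forall a f, Rabs f <= K * N ->
                    2 * a * f <= 2 * Rabs a * (K * N)).
    { intros z f Hf. apply Rle_trans with (2 * Rabs z * Rabs f).
      - rewrite !Rmult_assoc, <- Rabs_mult. pose proof (Rle_abs (z * f)). lra.
      - apply Rmult_le_compat_l; [pose proof (Rabs_pos z); lra | exact Hf]. }
    (* Each component of the field differs by at most [K * N], and the coordinate differences add up
       to [N]. With [N ^ 2 <= 4 * D u] this gives the rate [8 * K]. *)
    apply Rle_trans with (2 * N * (K * N)); [|nra].
    replace (2 * N * (K * N)) with
      (2 * Rabs (Q1 u - U1 u) * (K * N) + 2 * Rabs (Q2 u - U2 u) * (K * N)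
       + 2 * Rabs (P1 u - V1 u) * (K * N) + 2 * Rabs (P2 u - V2 u) * (K * N))
      by (unfold N at 5; unfold phase_dist, x, y; simpl; ring).
    unfold dD. repeat apply Rplus_le_compat; apply Hprod; assumption.
Qed.

(** * Transversality at the collision and continuity of the collision value *)

Lemma hamilton_on_le (m b b' : R) (Q1 Q2 P1 P2 : R -> R) :
  b' <= b -> hamilton_on m b Q1 Q2 P1 P2 -> hamilton_on m b' Q1 Q2 P1 P2.
Proof. intros Hb H s Hs; apply H; lra. Qed.

Lemma is_solution_hamilton_on (m r lo hi b : R) (Q1 Q2 P1 P2 : R -> R) :
  lo < 0 -> b < hi -> is_solution m r lo hi Q1 Q2 P1 P2 ->
  hamilton_on m b Q1 Q2 P1 P2.
Proof. intros Hlo Hhi [_ H] s Hs; apply H; lra. Qed.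

Lemma Gamma_initial (m r : R) : 0 < m ->
  Gamma m r 0 0 (2 * Rpower m (3 / 2)) = 0.
Proof.
  intros Hm.
  assert (Hpow : Rpower m (3 / 2) ^ 2 = m ^ 3).
  { rewrite <- (Rpower_pow 2), Rpower_mult by apply exp_pos.
    rewrite <- (Rpower_pow 3) by exact Hm. f_equal. simpl; field. }
  unfold Gamma, energy, Rdiv.
  (* Both inverses are multiplied by [0 ^ 2], so they may be replaced by arbitrary numbers; the
     denominator that depends on [m] is then the only one of concern to [field]. *)
  generalize (/ (r ^ 2 + 0 ^ 2)) (/ (2 * r ^ 2 + 0 ^ 2)); intros u v.
  fold (3 / 2). rewrite (Rpow_mult_distr 2), Hpow. field. lra.
Qed.

(** At [q1 = 0] the velocity of [Q1] is a positive multiple of [p1]. If [p1 = 0], the energy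
    relation reduces to [- 2 * m * q2 ^ 2 = 0], which is impossible. *)
Lemma Q1_transversal (m q2 p1 p2 : R) : 0 < m -> q2 <> 0 ->
  Gamma m 0 q2 p1 p2 = 0 -> dQ1 m 0 q2 p1 p2 <> 0.
Proof.
  intros Hm Hq HG Hd.
  assert (Hq2 := pow2_gt_0 q2 Hq).
  assert (Hp1 : p1 = 0).
  { assert (H : q2 ^ 2 * (/ 8 + / (8 * m)) * p1 = 0).
    { rewrite <- Hd. unfold dQ1. field. lra. }
    apply Rmult_integral in H. destruct H as [H|H]; [|exact H].
    assert (0 < / (8 * m)) by (apply Rinv_0_lt_compat; lra).
    assert (0 < q2 ^ 2 * (/ 8 + / (8 * m))) by (apply Rmult_lt_0_compat; lra).
    lra. }
  rewrite Hp1 in HG. unfold Gamma, energy in HG.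
  assert (- 2 * m * q2 ^ 2 = 0); [|nra].
  rewrite <- HG. field. repeat split; nra.
Qed.

(** Since [Q2] is positive on the interval, a zero of [Q1] before [s1] would be an earlier
    collision. By continuity [Q1] keeps its initial sign. *)
Lemma Q1_pos_before_SBC (m s1 : R) (Q1 Q2 P1 P2 : R -> R) :
  0 < m -> hamilton_on m s1 Q1 Q2 P1 P2 -> 0 < Q1 0 ->
  first_SBC Q1 Q2 s1 -> (forall s, 0 < s <= s1 -> 0 < Q2 s) ->
  forall s, 0 <= s < s1 -> 0 < Q1 s.
Proof.
  intros Hm Hsol Hr [_ [_ Hfirst]] HQ2 s Hs.
  apply Rnot_le_lt; intros Hneg.
  destruct (first_hit (fun u => - Q1 u) 0 s 0) as [t [Ht [Ht0 _]]]; try lra.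
  { intros u Hu. apply continuity_pt_opp.
    apply (hamilton_continuity m s1 Q1 Q2 P1 P2 Hm Hsol u); lra. }
  assert (t <> 0) by (intros ->; lra).
  apply (Hfirst t ltac:(lra)). split; [lra|].
  pose proof (HQ2 t ltac:(lra)); lra.
Qed.

Lemma sqr_lt_Rabs (x e : R) : 0 < e -> x ^ 2 < e ^ 2 -> Rabs x < e.
Proof. intros He H. apply Rabs_def1; nra. Qed.

Theorem theorem2 (m A0 : R) (Q1 Q2 P1 P2 : R -> R -> R) (s1 : R -> R)
  (hm : 0 < m)
  (hA0 : is_A0 m A0)
  (hsol : forall r, 0 < r <= sqrt A0 ->
     exists lo hi, lo < 0 /\ s1 r < hi /\
       is_solution m r lo hi (fun s => Q1 s r) (fun s => Q2 s r)
                             (fun s => P1 s r) (fun s => P2 s r))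
  (hs1 : forall r, 0 < r <= sqrt A0 ->
     first_SBC (fun s => Q1 s r) (fun s => Q2 s r) (s1 r))
  (hSBC : forall r, 0 < r <= sqrt A0 -> 0 < Q2 (s1 r) r /\ Q1 (s1 r) r = 0)
  (hQ2 : forall r, 0 < r <= sqrt A0 ->
     forall s, 0 < s <= s1 r -> 0 < Q2 s r) :
  continuous_on (fun r => 0 < r <= sqrt A0) (fun r => P2 (s1 r) r).
Proof.
  assert (hpos : forall r, 0 < r <= sqrt A0 ->
                 forall s, 0 <= s < s1 r -> 0 < Q1 s r).
  { intros r Hr. destruct (hsol r Hr) as [lo [hi [Hlo [Hhi Hs]]]].
    apply (Q1_pos_before_SBC m (s1 r) _ (fun s => Q2 s r)
             (fun s => P1 s r) (fun s => P2 s r)); auto.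
    - exact (is_solution_hamilton_on _ _ _ _ _ _ _ _ _ Hlo Hhi Hs).
    - destruct Hs as [[-> _] _]. apply Hr. }
  intros r0 Hr0. apply filterlim_locally. intros e.
  destruct (hsol r0 Hr0) as [lo [hi [Hlo [Hhi Hs0]]]].
  assert (Hs10 : 0 < s1 r0) by apply (hs1 r0 Hr0).
  destruct (hSBC r0 Hr0) as [HQ20 HQ10].
  (* The reference solution is followed beyond its collision, to see [Q1] change sign. *)
  set (B := (s1 r0 + hi) / 2).
  assert (HB : s1 r0 < B < hi) by (unfold B; lra).
  assert (HsolB := is_solution_hamilton_on _ _ _ _ B _ _ _ _ Hlo
                     (proj2 HB) Hs0).
  assert (Hct := hamilton_continuity _ _ _ _ _ _ hm HsolB).
  pose proof (cond_pos e) as He.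
  destruct (continuity_pt_eps (fun s => P2 s r0) (s1 r0) (e / 2))
    as [eta [Heta HP2]]; [apply Hct; lra | lra |].
  (* Half-width of the window that will contain [s1 r]: small enough for the continuity of [P2] in
     time, and for both [s1 r0 - n / 2] and the crossing time [t] to stay in the domain. *)
  set (n := Rmin eta (Rmin (s1 r0) (B - s1 r0))).
  assert (Hn : 0 < n /\ n <= eta /\ n <= s1 r0 /\ n <= B - s1 r0).
  { unfold n. split; [repeat apply Rmin_pos; lra|].
    pose proof (Rmin_l eta (Rmin (s1 r0) (B - s1 r0))).
    pose proof (Rmin_r eta (Rmin (s1 r0) (B - s1 r0))).
    pose proof (Rmin_l (s1 r0) (B - s1 r0)).
    pose proof (Rmin_r (s1 r0) (B - s1 r0)). lra. }
  destruct Hn as [Hn [Hneta [Hns HnB]]].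
  destruct (hamilton_explicit _ _ _ _ _ _ hm HsolB (s1 r0) ltac:(lra))
    as [HdQ1 _].
  rewrite HQ10 in HdQ1.
  destruct (crossing (fun s => Q1 s r0) 0 (s1 r0) _ HdQ1) with (e := n)
    as [t [Ht HQ1t]]; auto.
  { apply Q1_transversal; [exact hm | lra |].
    assert (HE := energy_conservation _ _ _ _ _ _ hm HsolB (s1 r0) ltac:(lra)).
    cbv beta in HE. rewrite HQ10 in HE. rewrite HE.
    destruct Hs0 as [[-> [-> [-> ->]]] _]. apply Gamma_initial; exact hm. }
  destruct (continuity_ab_min (fun s => Q1 s r0) 0 (s1 r0 - n / 2))
    as [x [Hxmin Hx]]; [lra | intros; apply Hct; lra |].
  assert (HQ1x : 0 < Q1 x r0) by (apply hpos; [exact Hr0 | lra]).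
  (* The three bounds control in turn the error in [P2], a collision of the perturbed motion that is
     too early, and one that is too late. *)
  set (d := Rmin (e / 2) (Rmin (Q1 x r0) (- Q1 t r0))).
  assert (Hd : 0 < d /\ d <= e / 2 /\ d <= Q1 x r0 /\ d <= - Q1 t r0).
  { unfold d. split; [repeat apply Rmin_pos; lra|].
    pose proof (Rmin_l (e / 2) (Rmin (Q1 x r0) (- Q1 t r0))).
    pose proof (Rmin_r (e / 2) (Rmin (Q1 x r0) (- Q1 t r0))).
    pose proof (Rmin_l (Q1 x r0) (- Q1 t r0)).
    pose proof (Rmin_r (Q1 x r0) (- Q1 t r0)). lra. }
  destruct Hd as [Hd [Hde [HdQ HdQ']]].
  assert (Hsolt := hamilton_on_le m B t _ _ _ _ ltac:(lra) HsolB).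
  destruct (continuous_dependence m t _ _ _ _ hm ltac:(lra) Hsolt (d ^ 2)
              ltac:(nra)) as [w [Hw Hdep]].
  assert (Hw' : 0 < sqrt w) by (apply sqrt_lt_R0; exact Hw).
  (* The initial data differ only in [Q1], so the initial [sqdist] is [(r0 - r) ^ 2]; hence the
     radius [sqrt w]. *)
  exists (mkposreal _ Hw'). intros r Hball Hr.
  change (Rabs (r - r0) < sqrt w) in Hball.
  change (Rabs (P2 (s1 r) r - P2 (s1 r0) r0) < e).
  destruct (hsol r Hr) as [lo' [hi' [Hlo' [Hhi' Hs]]]].
  destruct (hSBC r Hr) as [_ HQ1r].
  assert (Hs1r : 0 < s1 r) by apply (hs1 r Hr).
  (* The perturbed solution is only known to exist slightly beyond [s1 r], which is not yet compared
     with [t]; hence the minimum. *)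
  assert (Hclose : forall s, 0 <= s <= Rmin (s1 r) t ->
    Rabs (Q1 s r0 - Q1 s r) < d /\ Rabs (P2 s r0 - P2 s r) < d).
  { intros s Hst.
    pose proof (Rmin_l (s1 r) t); pose proof (Rmin_r (s1 r) t).
    assert (Hlt := Hdep (Rmin (s1 r) t)
      (fun s => Q1 s r) (fun s => Q2 s r) (fun s => P1 s r) (fun s => P2 s r)
      ltac:(lra)
      (is_solution_hamilton_on _ _ _ hi' (Rmin (s1 r) t) _ _ _ _
         Hlo' ltac:(lra) Hs)).
    unfold sqdist in Hlt.
    destruct Hs0 as [[E1 [E2 [E3 E4]]] _].
    destruct Hs as [[F1 [F2 [F3 F4]]] _].
    rewrite E1, E2, E3, E4, F1, F2, F3, F4 in Hlt.
    assert (Hini : (r0 - r) ^ 2 < w).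
    { rewrite <- (pow2_sqrt w) by lra. rewrite <- pow2_abs.
      rewrite Rabs_minus_sym. pose proof (Rabs_pos (r - r0)). nra. }
    specialize (Hlt ltac:(nra) s Hst).
    pose proof (pow2_ge_0 (Q1 s r0 - Q1 s r)).
    pose proof (pow2_ge_0 (Q2 s r0 - Q2 s r)).
    pose proof (pow2_ge_0 (P1 s r0 - P1 s r)).
    pose proof (pow2_ge_0 (P2 s r0 - P2 s r)).
    split; apply sqr_lt_Rabs; lra. }
  (* Otherwise the perturbed [Q1] would still be positive at [t], although it is within [- Q1 t r0]
     of the negative value [Q1 t r0]. *)
  assert (Hle : s1 r <= t).
  { apply Rnot_lt_le; intros Hgt.
    destruct (Hclose t) as [HQ _]; [rewrite Rmin_right; lra|].
    assert (H := hpos r Hr t ltac:(lra)).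
    apply Rabs_def2 in HQ. lra. }
  destruct (Hclose (s1 r)) as [HQ HP]; [rewrite Rmin_left; lra|].
  rewrite HQ1r in HQ. apply Rabs_def2 in HQ.
  (* The perturbed [Q1] vanishes at [s1 r], so the reference [Q1] is below [d] there, hence below
     its minimum on the interval up to [s1 r0 - n / 2]. *)
  assert (Hge : s1 r0 - n / 2 < s1 r).
  { apply Rnot_le_lt; intros Hlt.
    assert (H := Hxmin (s1 r) ltac:(lra)). lra. }
  assert (HP' := HP2 (s1 r) ltac:(apply Rabs_def1; lra)).
  apply Rabs_def2 in HP; apply Rabs_def2 in HP'; apply Rabs_def1; lra.
Qed.
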